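(* Let $R$ be a principal ideal domain with the $0$-grading (i.e., $R_0 = R$ and $R_n = 0$ for all $n>0$) and let $M$ be a finitely generated graded $R$-module. Then $M$ admits a graded prime power decomposition over $R$, and the signatures of all such graded decompositions of $M$ coincide.
   Context: $\mathbb{N}$ contains $0$; all gradings are over $\mathbb{N}$. A graded ring is a ring $R$ together with additive subgroups $(R_n)_{n \in \mathbb{N}}$ such that $(R,+)$ is the internal direct sum of the $R_n$ and $R_n \cdot R_m \subset R_{n+m}$ for all $n,m \in \mathbb{N}$. Elements of $R_n$ are called homogeneous of degree $n$; an element is homogeneous if it is homogeneous of some degree. A graded module over a graded ring $R$ is an $R$-module $M$ with additive subgroups $(M_n)_{n \in \mathbb{N}}$ such that $(M,+)$ is the internal direct sum of the $M_n$ and $R_n \cdot M_m \subset M_{n+m}$ for all $n,m \in \mathbb{N}$. Homomorphisms of graded $R$-modules are $R$-linear maps that preserve the grading. For $n \in \mathbb{N}$, $\Sigma^n M$ is the shifted graded module with $(\Sigma^n M)_j = M_{j-n}$ for $j \geq n$ and $(\Sigma^n M)_j = 0$ for $j<n$. Direct sums are graded degreewise, and for a submodule $M' \subset M$ generated by homogeneous elements, $M/M'$ is graded by $(M_n/(M' \cap M_n))_{n \in \mathbb{N}}$. A graded prime power decomposition of a graded $R$-module $M$ over $R$ is an isomorphism of graded $R$-modules $$M \cong \bigoplus_{j=1}^N \Sigma^{n_j} R/(p_j^{k_j})$$ with $N \in \mathbb{N}$, $n_1,\dots,n_N \in \mathbb{N}$, $k_1,\dots,k_N \in \mathbb{N}$,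 and homogeneous prime elements $p_1,\dots,p_N \in R$; here the right-hand side carries the canonical grading. The signature of such a decomposition is the multiset of all pairs $(n_j, R^\times \cdot p_j^{k_j})$ with $j \in \{1,\dots,N\}$, where $R^\times$ is the group of units of $R$.
   Formalization: The exponents k_j are required to be at least 1, since summands R/(p^0) = 0 could be added freely and the signatures would not coincide (e.g. M = 0); 0 counts as a prime element, so that free summands R/(0) are allowed. *)

(* Defs.v *)
From HB Require Import structures.
From mathcomp Require Import all_boot all_algebra.
From mathcomp Require Import finmap multiset.
From mathcomp Require Import boolp classical_sets.

Set Implicit Arguments.
Unset Strict Implicit.
Unset Printing Implicit Defensive.

Import GRing.Theory.
Local Open Scope ring_scope.
Local Open Scope quotient_scope.
Local Open Scope classical_set_scope.

Definition is_ideal (R : idomainType) (I : set R) : Prop :=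
  [/\ I 0, forall x y, I x -> I y -> I (x + y) &
      forall c x, I x -> I (c * x)].

Definition principal_ideal (R : idomainType) (a : R) : set R :=
  [set c * a | c in setT].

Definition is_PID (R : idomainType) : Prop :=
  forall I : set R, is_ideal I -> exists a : R, I = principal_ideal a.

(* A prime element generates a prime ideal. In particular 0 is a prime element
   of a domain, so that free summands R/(0) are of the form R/(p^k). *)
Definition prime_elem (R : idomainType) (p : R) : Prop :=
  p \isn't a GRing.unit /\
  forall a b : R, principal_ideal p (a * b) ->
    principal_ideal p a \/ principal_ideal p b.

Definition principal_pred (R : idomainType) (a : R) : {pred R} :=
  fun x => `[< principal_ideal a x >].

Lemma principal_zmod_closed (R : idomainType) (a : R) :
  zmod_closed (principal_pred a).
Proof.
split=> [|x y]; rewrite !unfold_in.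
  by apply/asboolP; exists 0; rewrite ?mul0r.
move=> /asboolP[c _ <-] /asboolP[d _ <-].
by apply/asboolP; exists (c - d); rewrite ?mulrBl.
Qed.

HB.instance Definition _ (R : idomainType) (a : R) :=
  GRing.isZmodClosed.Build R (principal_pred a) (principal_zmod_closed a).

Definition cyclic_module (R : idomainType) (a : R) : Type :=
  Quotient.quot (principal_pred a).

HB.instance Definition _ (R : idomainType) (a : R) :=
  Choice.on (cyclic_module a).
HB.instance Definition _ (R : idomainType) (a : R) :=
  GRing.Zmodule.on (cyclic_module a).

Section CyclicModule.
Variables (R : idomainType) (a : R).

Definition cyclic_pi (x : R) : cyclic_module a :=
  \pi_(Quotient.quot (principal_pred a)) x.

Lemma cyclic_pi_repr (u : cyclic_module a) :
  cyclic_pi (repr (u : Quotient.quot (principal_pred a))) = u.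
Proof. exact: reprK. Qed.

Lemma cyclic_piD x y : cyclic_pi (x + y) = cyclic_pi x + cyclic_pi y.
Proof. by rewrite /cyclic_pi pi_addr. Qed.

Lemma cyclic_pi_eq x y :
  cyclic_pi x = cyclic_pi y <-> principal_ideal a (x - y).
Proof.
have E : (cyclic_pi x == cyclic_pi y) = (x - y \in principal_pred a).
  by rewrite Quotient.idealrBE.
by split=> [/eqP|/asboolP H]; [rewrite E => /asboolP | apply/eqP; rewrite E].
Qed.

Definition cyclic_scale (r : R) (u : cyclic_module a) : cyclic_module a :=
  cyclic_pi (r * repr (u : Quotient.quot (principal_pred a))).

Lemma cyclic_scale_pi r x : cyclic_scale r (cyclic_pi x) = cyclic_pi (r * x).
Proof.
apply/cyclic_pi_eq; rewrite -mulrBr.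
have /cyclic_pi_eq[c _ <-] := cyclic_pi_repr (cyclic_pi x).
by exists (r * c) => //; rewrite mulrA.
Qed.

Lemma cyclic_scaleA r s u :
  cyclic_scale r (cyclic_scale s u) = cyclic_scale (r * s) u.
Proof. by rewrite -[u]cyclic_pi_repr !cyclic_scale_pi mulrA. Qed.

Lemma cyclic_scale1 : left_id 1 cyclic_scale.
Proof. by move=> u; rewrite -[u]cyclic_pi_repr cyclic_scale_pi mul1r. Qed.

Lemma cyclic_scaleDr : right_distributive cyclic_scale +%R.
Proof.
move=> r u v; rewrite -[u]cyclic_pi_repr -[v]cyclic_pi_repr.
by rewrite -cyclic_piD !cyclic_scale_pi mulrDr cyclic_piD.
Qed.

Lemma cyclic_scaleDl u : {morph cyclic_scale^~ u : r s / r + s}.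
Proof.
move=> r s; rewrite -[u]cyclic_pi_repr !cyclic_scale_pi.
by rewrite mulrDl cyclic_piD.
Qed.

HB.instance Definition _ := GRing.Zmodule_isLmodule.Build R (cyclic_module a)
  cyclic_scaleA cyclic_scale1 cyclic_scaleDr cyclic_scaleDl.

End CyclicModule.

Definition dirsum (R : idomainType) (N : nat) (V : 'I_N -> lmodType R) : Type :=
  {dffun forall i : 'I_N, V i}.

HB.instance Definition _ (R : idomainType) (N : nat) (V : 'I_N -> lmodType R) :=
  Choice.on (dirsum V).

Section DirectSum.
Variables (R : idomainType) (N : nat) (V : 'I_N -> lmodType R).
Implicit Types (r s : R) (f g h : dirsum V).

Definition dirsum_zero : dirsum V := [ffun i => 0].
Definition dirsum_opp f : dirsum V := [ffun i => - f i].
Definition dirsum_add f g : dirsum V := [ffun i => f i + g i].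
Definition dirsum_scale r f : dirsum V := [ffun i => r *: f i].

Lemma dirsum_addA : associative dirsum_add.
Proof. by move=> f g h; apply/ffunP => i; rewrite !ffunE addrA. Qed.
Lemma dirsum_addC : commutative dirsum_add.
Proof. by move=> f g; apply/ffunP => i; rewrite !ffunE addrC. Qed.
Lemma dirsum_add0 : left_id dirsum_zero dirsum_add.
Proof. by move=> f; apply/ffunP => i; rewrite !ffunE add0r. Qed.
Lemma dirsum_addN : left_inverse dirsum_zero dirsum_opp dirsum_add.
Proof. by move=> f; apply/ffunP => i; rewrite !ffunE addNr. Qed.

HB.instance Definition _ := GRing.isZmodule.Build (dirsum V)
  dirsum_addA dirsum_addC dirsum_add0 dirsum_addN.

Lemma dirsum_scaleA r s f :
  dirsum_scale r (dirsum_scale s f) = dirsum_scale (r * s) f.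
Proof. by apply/ffunP => i; rewrite !ffunE scalerA. Qed.
Lemma dirsum_scale1 : left_id 1 dirsum_scale.
Proof. by move=> f; apply/ffunP => i; rewrite !ffunE scale1r. Qed.
Lemma dirsum_scaleDr : right_distributive dirsum_scale +%R.
Proof. by move=> r f g; apply/ffunP => i; rewrite !ffunE scalerDr. Qed.
Lemma dirsum_scaleDl f : {morph dirsum_scale^~ f : r s / r + s}.
Proof. by move=> r s; apply/ffunP => i; rewrite !ffunE scalerDl. Qed.

HB.instance Definition _ := GRing.Zmodule_isLmodule.Build R (dirsum V)
  dirsum_scaleA dirsum_scale1 dirsum_scaleDr dirsum_scaleDl.

End DirectSum.

Definition add_subgroup (V : zmodType) (A : set V) : Prop :=
  A 0 /\ forall x y, A x -> A y -> A (x - y).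

Definition internal_direct_sum (V : zmodType) (G : nat -> set V) : Prop :=
  (forall n, add_subgroup (G n)) /\
  forall x : V, exists! f : nat -> V,
    (forall n, G n (f n)) /\
    exists m, (forall n, (m <= n)%N -> f n = 0) /\ x = \sum_(n < m) f n.

Definition graded_ring (R : idomainType) (RG : nat -> set R) : Prop :=
  internal_direct_sum RG /\
  forall n m r s, RG n r -> RG m s -> RG (n + m)%N (r * s).

Definition graded_module (R : idomainType) (RG : nat -> set R)
    (M : lmodType R) (MG : nat -> set M) : Prop :=
  internal_direct_sum MG /\
  forall n m r x, RG n r -> MG m x -> MG (n + m)%N (r *: x).

Definition homogeneous (V : zmodType) (G : nat -> set V) (x : V) : Prop :=
  exists n, G n x.

Definition zero_grading (R : idomainType) : nat -> set R :=
  fun n => if n is 0%N then setT else [set 0].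

Arguments zero_grading R _ _ : clear implicits.

Lemma zero_grading_graded (R : idomainType) : graded_ring (zero_grading R).
Proof.
split; last first.
  case=> [|n] [|m] r s //= hr hs; first by rewrite hs mulr0.
    by rewrite hr mul0r.
  by rewrite hr mul0r.
split=> [[|n]|x]; first by [].
  by split=> //= x y -> ->; rewrite subr0.
exists (fun n => if n is 0%N then x else 0); split.
  split; first by case.
  exists 1%N; split; first by case.
  by rewrite big_ord1.
move=> f [Gf [m [fm ->]]]; apply/funext => -[|n]; last by rewrite (Gf n.+1).
case: m fm => [|m] fm; first by rewrite big_ord0 fm.
by rewrite big_ord_recl big1 ?addr0 // => i _; exact: (Gf i.+1).
Qed.

Definition shift_grading (V : zmodType) (n : nat) (G : nat -> set V) :
    nat -> set V :=
  fun j => if (n <= j)%N then G (j - n)%N else [set 0].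

(* The degree-n part R_n / ((a) `&` R_n) of R/(a), as a subgroup of R/(a). *)
Definition cyclic_grading (R : idomainType) (RG : nat -> set R) (a : R) :
    nat -> set (cyclic_module a) :=
  fun n => [set cyclic_pi a x | x in RG n].

Arguments cyclic_grading {R} RG a _ _.

Definition dirsum_grading (R : idomainType) (N : nat) (V : 'I_N -> lmodType R)
    (G : forall i, nat -> set (V i)) : nat -> set (dirsum V) :=
  fun n => [set f | forall i, G i n (f i)].

Definition graded_iso (R : idomainType) (M M' : lmodType R)
    (G : nat -> set M) (G' : nat -> set M') : Prop :=
  exists (f : {linear M -> M'}) (g : {linear M' -> M}),
    [/\ cancel f g, cancel g f,
        forall n x, G n x -> G' n (f x) &
        forall n y, G' n y -> G n (g y)].

Definition finitely_generated (R : idomainType) (M : lmodType R) : Prop :=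
  exists (n : nat) (g : 'I_n -> M),
    forall x : M, exists c : 'I_n -> R, x = \sum_(i < n) c i *: g i.

Record prime_power_data (R : idomainType) := PrimePowerData {
  ppd_size : nat;
  ppd_shift : 'I_ppd_size -> nat;
  ppd_prime : 'I_ppd_size -> R;
  ppd_exp : 'I_ppd_size -> nat }.

Definition ppd_summand (R : idomainType) (D : prime_power_data R)
    (j : 'I_(ppd_size D)) : lmodType R :=
  cyclic_module (ppd_prime j ^+ ppd_exp j).

Definition ppd_module (R : idomainType) (D : prime_power_data R) : lmodType R :=
  dirsum (@ppd_summand R D).

Definition ppd_grading (R : idomainType) (RG : nat -> set R)
    (D : prime_power_data R) : nat -> set (ppd_module D) :=
  @dirsum_grading R (ppd_size D) (@ppd_summand R D)
    (fun j => shift_grading (ppd_shift j)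
                (cyclic_grading RG (ppd_prime j ^+ ppd_exp j))).

Arguments ppd_grading {R} RG D _ _.

(* The exponents are positive: a summand R/(p^0) = 0 could be added or removed
   at will, and the signature would not be an invariant. *)
Definition graded_prime_power_decomposition (R : idomainType)
    (RG : nat -> set R) (M : lmodType R) (MG : nat -> set M)
    (D : prime_power_data R) : Prop :=
  [/\ forall j : 'I_(ppd_size D), prime_elem (ppd_prime j),
      forall j : 'I_(ppd_size D), homogeneous RG (ppd_prime j),
      forall j : 'I_(ppd_size D), (0 < ppd_exp j)%N &
      graded_iso MG (ppd_grading RG D)].

Definition unit_orbit (R : idomainType) (x : R) : set R :=
  [set u * x | u in [set u : R | u \is a GRing.unit]].

Definition ppd_signature (R : idomainType) (D : prime_power_data R) :
    {mset nat * set R}%mset :=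
  seq_mset [seq (ppd_shift j, unit_orbit (ppd_prime j ^+ ppd_exp j))
           | j <- enum 'I_(ppd_size D)].

(* Main.v *)
(** Existence. Each degree [M_n] is a finitely generated module. Among all first
    coefficients of nontrivial relations between generating families of [M_n] of a
    given length, take one, [a], that is minimal for divisibility. By Bezout, [a]
    divides all coefficients of its relation [a x + sum_i b_i x_i = 0] and the first
    coefficients of all other relations between the same generators, so
    [x + sum_i (b_i / a) x_i] spans a direct summand isomorphic to [R/(a)],
    complementary to the span of the [x_i]. Induction gives a sum of cyclic modules,
    and coprime factors of the orders split off one prime power at a time.

    Uniqueness. The multiplicity of [(n, R^* p^(k+1))] in the signature is the largest
    [m] for which there are [y_1, ..., y_m] in [M_n] killed by [p^(k+1)] whose multiples
    [p^k y_i] are linearly independent over [R/(p)] modulo [p^(k+1) M]. This covers the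
    free part as [p = 0], [k = 0]. *)

From HB Require Import structures.
Require Import Defs.
From mathcomp Require Import all_boot all_algebra.
From mathcomp Require Import finmap multiset.
From mathcomp Require Import boolp classical_sets.
From mathcomp Require Import ring.

Set Implicit Arguments.
Unset Strict Implicit.
Unset Printing Implicit Defensive.

Import GRing.Theory.
Local Open Scope ring_scope.
Local Open Scope classical_set_scope.

(** * Divisibility and prime elements in a domain *)

Section Divisibility.
Variable R : idomainType.
Implicit Types (a b c d p q : R) (k l : nat).

Lemma principal_idealP a b : principal_ideal a b <-> exists c, b = c * a.
Proof. by split=> [[c _ <-]|[c ->]]; exists c. Qed.

Lemma principal_ideal_refl a : principal_ideal a a.
Proof. by exists 1; rewrite ?mul1r. Qed.

Lemma principal_ideal_trans b a c :
  principal_ideal a b -> principal_ideal b c -> principal_ideal a c.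
Proof. by move=> [d _ <-] [e _ <-]; exists (e * d); rewrite ?mulrA. Qed.

Lemma principal_ideal0 a : principal_ideal a 0.
Proof. by exists 0; rewrite ?mul0r. Qed.

Lemma principal_ideal_mull a b c :
  principal_ideal a b -> principal_ideal a (c * b).
Proof. by move=> [d _ <-]; exists (c * d); rewrite ?mulrA. Qed.

Lemma principal_idealD a b c :
  principal_ideal a b -> principal_ideal a c -> principal_ideal a (b + c).
Proof. by move=> [d _ <-] [e _ <-]; exists (d + e); rewrite ?mulrDl. Qed.

Lemma principal_ideal_sum a (I : finType) (P : pred I) (F : I -> R) :
  (forall i, P i -> principal_ideal a (F i)) ->
  principal_ideal a (\sum_(i | P i) F i).
Proof.
by move=> h; elim/big_ind: _ => //;
  [exact: principal_ideal0 | move=> x y; exact: principal_idealD].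
Qed.

Lemma principal_ideal_mul2l c a b : c != 0 ->
  principal_ideal (c * a) (c * b) -> principal_ideal a b.
Proof.
by move=> c0 [d _]; rewrite mulrCA => /(mulfI c0) <-; exists d.
Qed.

Lemma principal_ideal_unit a b :
  principal_ideal a b -> b \is a GRing.unit -> a \is a GRing.unit.
Proof. by move=> [c _ <-]; rewrite unitrM => /andP[]. Qed.

Lemma unit_orbit_refl a : unit_orbit a a.
Proof. by exists 1; rewrite ?mul1r //=; exact: unitr1. Qed.

Lemma unit_orbit_mull u a : u \is a GRing.unit -> unit_orbit (u * a) = unit_orbit a.
Proof.
move=> hu; apply/seteqP; split=> x [v /= hv <-].
  by exists (v * u); rewrite ?mulrA //= unitrM hv.
by exists (v / u); rewrite /= ?unitrM ?unitrV ?hv // mulrA divrK.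
Qed.

Lemma unit_orbit_eq a b : unit_orbit a = unit_orbit b ->
  exists2 u, u \is a GRing.unit & a = u * b.
Proof. by move=> E; have := unit_orbit_refl a; rewrite E => -[u /= hu <-]; exists u. Qed.

Lemma prime_elem_expr p a k : prime_elem p ->
  principal_ideal p (a ^+ k) -> principal_ideal p a.
Proof.
move=> [pU pP]; elim: k => [/principal_ideal_unit|k IH].
  by rewrite expr0 unitr1 (negbTE pU) => /(_ isT).
by rewrite exprS => /pP[].
Qed.

Lemma prime_elem_prod p (I : finType) (P : pred I) (F : I -> R) : prime_elem p ->
  (forall i, P i -> ~ principal_ideal p (F i)) ->
  ~ principal_ideal p (\prod_(i | P i) F i).
Proof.
move=> [pU pP] h; elim/big_ind: _ => //.
  by move=> /principal_ideal_unit; rewrite unitr1 (negbTE pU) => /(_ isT).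
by move=> x y hx hy /pP[].
Qed.

(** The prime [q = u * p] divides [u] or [p]. The first would make [p] a unit; the second makes [u]
    one. *)
Lemma prime_elem_assoc p q : prime_elem p -> prime_elem q -> q != 0 ->
  principal_ideal p q -> exists2 u, u \is a GRing.unit & q = u * p.
Proof.
move=> [pU _] [_ qP] q0 /principal_idealP[u E].
have := principal_ideal_refl q; rewrite {2}E => /qP[|] [v _ F].
  have pv : p * v = 1.
    by apply: (mulIf q0); rewrite mul1r -mulrA F mulrC.
  by case/negP: pU; apply/unitrPr; exists v.
have uv : u * v = 1.
  by apply: (mulIf q0); rewrite -mulrA F mul1r.
by exists u => //; apply/unitrPr; exists v.
Qed.

(* A summand [R/(q ^+ l.+1)] does not contribute to the Ulm invariant of
   [p ^+ k.+1] unless [q ^+ l.+1] and [p ^+ k.+1] are associated. *)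
Lemma other_prime_power_killed p q k l :
  prime_elem p -> prime_elem q -> (p = 0 -> k = 0%N) ->
  unit_orbit (q ^+ l.+1) <> unit_orbit (p ^+ k.+1) ->
  exists2 c, ~ principal_ideal p c &
    forall y, principal_ideal (q ^+ l.+1) (p ^+ k.+1 * y) ->
    exists e, principal_ideal (q ^+ l.+1) (c * (p ^+ k * y) - p ^+ k.+1 * e).
Proof.
move=> pP qP p0k neq.
have n1 : ~ principal_ideal p 1.
  by move/principal_ideal_unit; rewrite unitr1 (negbTE pP.1) => /(_ isT).
case: (pselect (principal_ideal p q)) => [pq|npq]; last first.
  (* If [p] does not divide [q], the order [q ^+ l.+1] of the summand kills it and is itself not
     divisible by [p]. *)
  exists (q ^+ l.+1) => [/(prime_elem_expr pP)//|y _].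
  by exists 0; rewrite mulr0 subr0 mulrC; apply: principal_ideal_mull;
    exact: principal_ideal_refl.
(* From here on [p] divides [q], and [c = 1] works in every case. *)
exists 1 => // y.
have [q0|q0] := eqVneq q 0.
  have [p0|p0] := eqVneq p 0.
    by case: neq; rewrite q0 p0 !expr0n.
  rewrite q0 expr0n /= => -[z _]; rewrite mulr0 => /esym/eqP.
  rewrite mulf_eq0 expf_eq0 (negbTE p0) andbF /= => /eqP ->.
  by exists 0; rewrite !mulr0 subr0; exact: principal_ideal0.
have [u uU qE] := prime_elem_assoc pP qP q0 pq.
have p0 : p != 0 by apply: contra_neq q0 => p0; rewrite qE p0 mulr0.
have uE m : principal_ideal (q ^+ l.+1) m <-> principal_ideal (p ^+ l.+1) m.
  rewrite qE exprMn; split=> -[c _ <-].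
    by exists (c * u ^+ l.+1); rewrite ?mulrA.
  by exists (c / u ^+ l.+1); rewrite // mulrA divrK // unitrX.
have [lk|kl|lk] := ltngtP l k; last first.
- by case: neq; rewrite lk qE exprMn unit_orbit_mull // unitrX.
(* For [k < l], [p ^+ m.+1] divides [y], so [p ^+ k * y] is already a multiple of [p ^+ k.+1]. *)
- have {kl} [m El] : exists m, l = (k + m.+1)%N.
    by exists (l - k.+1)%N; rewrite addnS -addSn subnKC.
  move=> /uE; rewrite El -addSn exprD => /principal_ideal_mul2l.
  rewrite expf_neq0 // => /(_ isT) [c _ <-]; exists (c * p ^+ m).
  rewrite [X in principal_ideal _ X](_ : _ = 0); last by rewrite !exprS; ring.
  exact: principal_ideal0.
(* For [l < k], [p ^+ l.+1] divides [p ^+ k], so [e = 0] suffices. *)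
move=> _; exists 0; apply/uE; rewrite mulr0 subr0 mul1r mulrC -(subnK lk) exprD mulrA.
by apply: principal_ideal_mull; exact: principal_ideal_refl.
Qed.
End Divisibility.

(** * Bezout relations and prime factors in a principal ideal domain *)

Section PrincipalIdealDomain.
Variables (R : idomainType) (hR : is_PID R).
Implicit Types (a b c d p : R).

(** Ascending chain condition: without a minimal element, choice gives a sequence of ever stricter
    divisors. The union of the ideals they generate is generated by some [d], which already lies in
    one of them, so the chain stops there. *)
Lemma pid_divisibility_minimal (P : set R) : (exists a, P a) ->
  exists2 a, P a & forall b, P b -> principal_ideal b a -> principal_ideal a b.
Proof.
move=> [a0 Pa0]; apply: contrapT => hP.
have step a : exists b, P a -> [/\ P b, principal_ideal b a & ~ principal_ideal a b].
  case: (pselect (P a)) => [Pa|]; last by exists 0.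
  apply: contrapT => hb; apply: hP; exists a => // b Pb ba.
  by apply: contrapT => ab; apply: hb; exists b.
have [f fP] := choice step.
pose u n := iter n f a0.
have Pu n : P (u n) by elim: n => // n /fP[].
have uS n : principal_ideal (u n.+1) (u n) by have [] := fP _ (Pu n).
have uD n m : principal_ideal (u (n + m)%N) (u n).
  elim: m => [|m IH]; first by rewrite addn0; exact: principal_ideal_refl.
  by rewrite addnS; apply: principal_ideal_trans IH.
have [|d dE] := hR (I := [set x | exists n, principal_ideal (u n) x]).
  split; first by exists 0%N; exact: principal_ideal0.
    move=> x y [n nx] [m my]; exists (n + m)%N; apply: principal_idealD.
      exact: principal_ideal_trans nx.
    by apply: principal_ideal_trans my; rewrite addnC.
  by move=> c x [n nx]; exists n; exact: principal_ideal_mull.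
have [n nd] : exists n, principal_ideal (u n) d.
  by rewrite -[exists n, _]/([set x | exists n, principal_ideal (u n) x] d) dE;
    exact: principal_ideal_refl.
have [_ _] := fP _ (Pu n); apply; apply: principal_ideal_trans nd _.
by rewrite -dE; exists n.+1; exact: principal_ideal_refl.
Qed.

Lemma pid_bezout a b : exists d u v,
  [/\ d = u * a + v * b, principal_ideal d a & principal_ideal d b].
Proof.
have [|d dE] := hR (I := [set x | exists u v, x = u * a + v * b]).
  split; first by exists 0, 0; ring.
    by move=> _ _ [u [v ->]] [u' [v' ->]]; exists (u + u'), (v + v'); ring.
  by move=> c _ [u [v ->]]; exists (c * u), (c * v); ring.
have [u [v uv]] : [set x | exists u v, x = u * a + v * b] d.
  by rewrite dE; exact: principal_ideal_refl.
by exists d, u, v; split; rewrite // -dE; [exists 1, 0 | exists 0, 1]; ring.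
Qed.

(** The gcd [d] of [p] and [c] is a factor of the prime [p], so it is a unit or a multiple of [p];
    in the latter case [p] divides [c]. *)
Lemma pid_prime_bezout p c : prime_elem p -> p != 0 ->
  ~ principal_ideal p c -> exists u v, u * p + v * c = 1.
Proof.
move=> [pU pP] p0 pc; have [d [u [v [dE [e _ ep] dc]]]] := pid_bezout p c.
have := principal_ideal_refl p; rewrite -{2}ep => /pP[] [f _ fE].
  have d1 : f * d = 1 by apply: (mulfI p0); rewrite -{2}ep mulr1 -fE; ring.
  by exists (f * u), (f * v); rewrite -d1 dE; ring.
by case: pc; apply: principal_ideal_trans dc; exists f.
Qed.

Lemma pid_prime_expr_bezout p c k : prime_elem p -> p != 0 ->
  ~ principal_ideal p c -> exists u v, u * p ^+ k + v * c = 1.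
Proof.
move=> pP p0 pc; have [u [v uv]] := pid_prime_bezout pP p0 pc.
elim: k => [|k [u' [v' uv']]]; first by exists 1, 0; ring.
exists (u' * u), (u' * p ^+ k * v + v').
by rewrite -uv' -[u' * p ^+ k in RHS]mulr1 -uv exprS; ring.
Qed.

(** A non-unit divisor [p] of [a] that is minimal for divisibility is prime. If [p] divides [b * c],
    consider the gcd of [p] and [b]: if it is a unit, Bezout gives that [p] divides [c]; otherwise
    minimality makes [p] divide it, hence [b]. *)
Lemma pid_prime_divisor a : a \isn't a GRing.unit ->
  exists2 p, prime_elem p & principal_ideal p a.
Proof.
move=> aU.
have [|p [pU pa] pmin] := @pid_divisibility_minimal
  [set p | p \isn't a GRing.unit /\ principal_ideal p a].
  by exists a; split=> //; exact: principal_ideal_refl.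
exists p => //; split=> // b c pbc.
have [d [u [v [dE dp db]]]] := pid_bezout p b.
have [dU|dU] := boolP (d \is a GRing.unit).
  right; rewrite -[c](mulKr dU) dE mulrDl; apply: principal_ideal_mull.
  apply: principal_idealD; last by rewrite -mulrA; exact: principal_ideal_mull.
  by exists (u * c) => //; ring.
left; apply: principal_ideal_trans db; apply: pmin => //; split=> //.
exact: principal_ideal_trans pa.
Qed.

(** Instead of a maximal exponent, a cofactor [c] minimal for divisibility is taken. If [p] divided
    it, [c / p] would be a cofactor as well, and minimality would make [p] a unit. *)
Lemma pid_prime_power_split a : a != 0 -> a \isn't a GRing.unit ->
  exists p k c, [/\ prime_elem p, p != 0, ~ principal_ideal p c & a = p ^+ k.+1 * c].
Proof.
move=> a0 aU; have [p pP [e _ ep]] := pid_prime_divisor aU.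
have p0 : p != 0 by apply: contra_neq a0 => p0; rewrite -ep p0 mulr0.
have [|c [k aE] cmin] := @pid_divisibility_minimal
  [set c | exists k, a = p ^+ k.+1 * c].
  by exists e, 0%N; rewrite -ep; ring.
exists p, k, c; split=> // -[d _ dE].
have [||f _ fE] := cmin d.
- by exists k.+1; rewrite aE -dE [p ^+ k.+2]exprS; ring.
- by exists p; rewrite // mulrC.
have d0 : d != 0 by apply: contra_neq a0 => d0; rewrite aE -dE d0; ring.
case/negP: pP.1; apply/unitrPr; exists f; apply: (mulfI d0).
by rewrite mulr1 -{2}fE -dE; ring.
Qed.

End PrincipalIdealDomain.

(** * Spans and direct families in a module *)

Section Span.
Variables (R : idomainType) (M : lmodType R).
Implicit Types (x y z : M) (s t : seq M) (N : set M) (a b c p : R).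

Definition is_submodule N : Prop :=
  [/\ N 0, forall x y, N x -> N y -> N (x + y) & forall c x, N x -> N (c *: x)].

Fixpoint seq_span s : set M :=
  if s is x :: s' then [set z | exists c y, seq_span s' y /\ z = c *: x + y]
  else [set 0].

(** Generators may have torsion, so a relation is required to vanish term by term, not coefficient
    by coefficient. *)
Fixpoint direct s : Prop :=
  if s is x :: s' then
    (forall c y, seq_span s' y -> c *: x + y = 0 -> c *: x = 0) /\ direct s'
  else True.

Definition annihilated_by x a : Prop :=
  forall c, c *: x = 0 <-> principal_ideal a c.

(** The prime may be 0, so that generators of free summands are included. *)
Definition primary x : Prop := exists p k,
  prime_elem p /\ annihilated_by x (p ^+ k.+1).

Lemma seq_span_submodule s : is_submodule (seq_span s).
Proof.
elim: s => [|x s [s0 sD sZ]] /=.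
  split=> //= [_ _ -> ->|c _ ->]; [exact: addr0 | exact: scaler0].
split.
- by exists 0, 0; rewrite scale0r addr0.
- move=> _ _ [c [y [hy ->]]] [d [z [hz ->]]]; exists (c + d), (y + z).
  by split; [exact: sD | rewrite scalerDl addrACA].
- move=> b _ [c [y [hy ->]]]; exists (b * c), (b *: y).
  by split; [exact: sZ | rewrite scalerDr scalerA].
Qed.

Lemma seq_spanD s x y : seq_span s x -> seq_span s y -> seq_span s (x + y).
Proof. by have [_ + _] := seq_span_submodule s; exact. Qed.

Lemma seq_spanZ s c x : seq_span s x -> seq_span s (c *: x).
Proof. by have [_ _ +] := seq_span_submodule s; exact. Qed.

Lemma mem_seq_span s x : x \in s -> seq_span s x.
Proof.
elim: s => //= y s IH; rewrite in_cons => /orP[/eqP ->|/IH xs].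
  by exists 1, 0; rewrite scale1r addr0; have [] := seq_span_submodule s.
by exists 0, x; rewrite scale0r add0r.
Qed.

Lemma seq_span_sub s N : is_submodule N -> (forall x, x \in s -> N x) ->
  seq_span s `<=` N.
Proof.
move=> [N0 ND NZ]; elim: s => [_ _ -> //|x s IH] hs _ /= [c [y [hy ->]]].
apply: ND; first by apply/NZ/hs; rewrite mem_head.
by apply: IH => // z zs; apply: hs; rewrite in_cons zs orbT.
Qed.

Lemma seq_span_subset s t : (forall x, x \in s -> seq_span t x) ->
  seq_span s `<=` seq_span t.
Proof. by apply: seq_span_sub; exact: seq_span_submodule. Qed.

Lemma seq_span_eq s t : (forall x, x \in s -> seq_span t x) ->
  (forall x, x \in t -> seq_span s x) -> seq_span s = seq_span t.
Proof. by move=> st ts; apply/seteqP; split; exact: seq_span_subset. Qed.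

Lemma seq_span_cons_eq x s t : seq_span s = seq_span t ->
  seq_span (x :: s) = seq_span (x :: t).
Proof. by move=> E; rewrite /= E. Qed.

Lemma seq_span_cat s t z : seq_span (s ++ t) z <->
  exists x y, [/\ seq_span s x, seq_span t y & z = x + y].
Proof.
elim: s z => [|w s IH] z /=.
  split=> [hz|[x [y [-> hy ->]]]]; last by rewrite add0r.
  by exists 0, z; rewrite add0r.
split=> [[c [_ [/IH[x [y [hx hy ->]]] ->]]]|[_ [y [[c [x [hx ->]]] hy ->]]]].
  by exists (c *: w + x), y; split=> //; [exists c, x | rewrite addrA].
by exists c, (x + y); split; [apply/IH; exists x, y | rewrite addrA].
Qed.

Lemma direct_cat s t : direct s -> direct t ->
  (forall x y, seq_span s x -> seq_span t y -> x + y = 0 -> x = 0) ->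
  direct (s ++ t).
Proof.
elim: s => //= x s IH [dx ds] dt disj; split.
  move=> c _ /seq_span_cat[y [z [hy hz ->]]]; rewrite addrA => E.
  by apply: (dx c y) => //; apply: disj E => //; exists c, y.
apply: IH => // y z hy hz; apply: disj => //.
by exists 0, y; rewrite scale0r add0r.
Qed.

Lemma seq_span_nth s z : seq_span s z <->
  exists c : nat -> R, z = \sum_(i < size s) c i *: s`_i.
Proof.
elim: s z => [|x s IH] z /=.
  by split=> [->|[c ->]]; [exists (fun=> 0); rewrite big_ord0 | rewrite big_ord0].
split=> [[a [_ [/IH[c ->] ->]]]|[c ->]].
  by exists (fun i => if i is j.+1 then c j else a); rewrite big_ord_recl.
exists (c 0%N), (\sum_(i < size s) c i.+1 *: s`_i); split.
  by apply/IH; exists (fun i => c i.+1).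
by rewrite big_ord_recl.
Qed.

Lemma direct_nth s (c : nat -> R) : direct s ->
  \sum_(i < size s) c i *: s`_i = 0 ->
  forall i, (i < size s)%N -> c i *: s`_i = 0.
Proof.
elim: s c => //= x s IH c [dx ds]; rewrite big_ord_recl /= => E.
have hs : seq_span s (\sum_(i < size s) c i.+1 *: s`_i).
  by apply/seq_span_nth; exists (fun i => c i.+1).
have c0 := dx _ _ hs E; case=> // i.
by rewrite ltnS; apply: (IH (fun i => c i.+1) ds); rewrite -[RHS]E c0 add0r.
Qed.

End Span.

Arguments seq_span : simpl never.

(** * Finitely generated modules as direct sums of primary cyclic modules *)

Section Decomposition.
Variables (R : idomainType) (hR : is_PID R) (M : lmodType R).
Implicit Types (x y z : M) (s t : seq M) (N : set M) (a b c d p : R).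

(** Here [n] counts the generators other than the one carrying the coefficient [a]. *)
Definition relation_coefficient n N a : Prop :=
  a != 0 /\ exists x s y, [/\ size s = n, seq_span (x :: s) = N,
                              seq_span s y & a *: x + y = 0].

(** The change of generators has determinant [u * a + v * b = 1], so it is invertible over [R]. *)
Lemma unimodular_span x y t u v a b : u * a + v * b = 1 ->
  seq_span (a *: x + b *: y :: (u *: y - v *: x) :: t) = seq_span (x :: y :: t).
Proof.
move=> uv; set X := a *: x + b *: y; set Y := u *: y - v *: x.
have comb c d : c *: X + d *: Y = (c * a - d * v) *: x + (c * b + d * u) *: y.
  rewrite /X /Y !scalerDr !scalerN !scalerA scalerBl scalerDl.
  by rewrite [d * u *: y - _]addrC addrACA.
have xE : x = u *: X + (- b) *: Y.
  rewrite comb -[LHS]scale1r -uv -[LHS]addr0 -(scale0r y).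
  by congr (_ *: _ + _ *: _); ring.
have yE : y = v *: X + a *: Y.
  rewrite comb -[LHS]scale1r -uv -[LHS]add0r -(scale0r x).
  by congr (_ *: _ + _ *: _); ring.
have span2 (z w : M) c d : seq_span (z :: w :: t) (c *: z + d *: w).
  by apply: seq_spanD; apply: seq_spanZ; apply: mem_seq_span; rewrite !inE eqxx ?orbT.
apply: seq_span_eq => z; rewrite !in_cons => /or3P[/eqP->|/eqP->|zt].
- exact: span2.
- by rewrite /Y addrC -scaleNr; exact: span2.
- by apply: mem_seq_span; rewrite !in_cons zt !orbT.
- by rewrite xE; exact: span2.
- by rewrite yE; exact: span2.
- by apply: mem_seq_span; rewrite !in_cons zt !orbT.
Qed.

(** Induction on [r], where [t] collects the generators already treated. For the next generator [x1]
    with coefficient [a1], let [d] be the gcd of [a] and [a1]. A unimodular change of [x] and [x1]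
    turns [a *: x + a1 *: x1] into [d] times one new generator, so [d] is a relation coefficient
    too; by minimality [a] divides [d], hence [a1]. *)
Lemma minimal_coefficient_divides n N a :
  (forall b, relation_coefficient n N b -> principal_ideal b a -> principal_ideal a b) ->
  a != 0 ->
  forall r t x w y, (size t + size r)%N = n -> seq_span (x :: t ++ r) = N ->
    seq_span t w -> seq_span r y -> a *: x + w + y = 0 ->
    exists2 y', seq_span r y' & y = a *: y'.
Proof.
move=> amin a0; elim=> [|x1 r IH] t x w y /= sz spN hw.
  by move=> ->; exists 0; rewrite ?scaler0.
move=> [a1 [y1 [hy1 ->]]] rel.
have [d [u [v [dE [e _ eE] [e1 _ e1E]]]]] := pid_bezout hR a a1.
have d0 : d != 0 by apply: contra_neq a0 => d0; rewrite -eE d0 mulr0.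
have uv : u * e + v * e1 = 1.
  by apply: (mulfI d0); rewrite {2}dE -eE -e1E; ring.
have spN' : seq_span (x :: x1 :: t ++ r) = N.
  rewrite -spN; apply: seq_span_eq => z zs; apply: mem_seq_span; move: zs;
  by rewrite !(in_cons, mem_cat); do !case: (_ \in _); rewrite ?orbT ?orbF.
have [f _ fE] : principal_ideal a a1.
  apply: (principal_ideal_trans (b := d)); last by exists e1.
  apply: amin; last by exists e.
  split=> //; exists (e *: x + e1 *: x1), ((u *: x1 - v *: x) :: t ++ r), (w + y1).
  split.
  - by rewrite /= size_cat -sz addnS.
  - by rewrite unimodular_span.
  - exists 0, (w + y1); rewrite scale0r add0r; split=> //.
    by apply/seq_span_cat; exists w, y1.
  - rewrite scalerDr !scalerA [d * e]mulrC eE [d * e1]mulrC e1E -[RHS]rel.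
    by rewrite -!addrA; congr (_ + _); rewrite addrCA.
have [|||||y' hy' y1E] := IH (x1 :: t) x (a1 *: x1 + w) y1.
- by rewrite /= addSnnS.
- by rewrite -spN'.
- by exists a1, w.
- by [].
- by rewrite -[RHS]rel -!addrA; congr (_ + _); rewrite addrCA.
exists (f *: x1 + y'); first by exists f, y'.
by rewrite y1E scalerDr scalerA [a * f]mulrC fE.
Qed.

Lemma span_direct s : exists t, seq_span t = seq_span s /\ direct t.
Proof.
have [n] := ubnP (size s); elim: n s => // n IH [|x s] /=; first by exists [::].
rewrite ltnS => sn.
(* If there is no such coefficient, [x] occurs in relations with coefficient 0 only, and [s] can be
   treated alone. *)
have [nr|hr] := pselect (forall a, ~ relation_coefficient (size s) (seq_span (x :: s)) a).
  have [t [ts td]] := IH _ sn; exists (x :: t); split.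
    exact: seq_span_cons_eq.
  split=> // c y; rewrite ts => hy rel; have [->|c0] := eqVneq c 0.
    exact: scale0r.
  by case: (nr c); split=> //; exists x, s, y.
have [|a [a0 [x0 [s0 [y0 [sz0 sp0 hy0 rel0]]]]] amin] := @pid_divisibility_minimal _ hR
    (relation_coefficient (size s) (seq_span (x :: s))).
  by apply: contrapT => h; apply: hr => a ha; apply: h; exists a.
have [|||||z hz zE] := minimal_coefficient_divides amin a0 (r := s0) (t := [::])
  (x := x0) (w := 0) (y := y0).
- by [].
- by [].
- by [].
- by [].
- by rewrite addr0.
have [t [ts td]] : exists t, seq_span t = seq_span s0 /\ direct t by apply: IH; rewrite sz0.
pose X := x0 + z.
have aX : a *: X = 0 by rewrite scalerDr -zE.
have spX : seq_span (X :: s0) = seq_span (x0 :: s0).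
  apply: seq_span_eq => w; rewrite in_cons => /orP[/eqP->|ws];
    try by apply: mem_seq_span; rewrite in_cons ws orbT.
    by exists 1, z; rewrite scale1r.
  exists 1, (- z); rewrite scale1r addrK; split=> //.
  by rewrite -scaleN1r; exact: seq_spanZ.
exists (X :: t); split; first by rewrite -sp0 -spX; exact: seq_span_cons_eq.
split=> // c y; rewrite ts => hy rel.
suff [e _ <-] : principal_ideal a c by rewrite -scalerA aX scaler0.
have [c0|c0] := eqVneq c 0; first by rewrite c0; exact: principal_ideal0.
(* Combining the relations with first coefficients [a] and [c] by Bezout gives one with first
   coefficient their gcd [d], so [a] divides [d] and thus [c]. *)
have [d [u [v [dE da dc]]]] := pid_bezout hR a c.
apply: principal_ideal_trans dc; apply: amin => //.
have d0 : d != 0 by apply: contra_neq a0 => d0; case: da => e _ <-; rewrite d0 mulr0.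
split=> //; exists x0, s0, (u *: y0 + v *: (c *: z + y)); split=> //.
  by apply: seq_spanD; apply: seq_spanZ => //; apply: seq_spanD => //; exact: seq_spanZ.
rewrite dE scalerDl addrACA -!scalerA -!scalerDr rel0 addrA -scalerDr rel.
by rewrite !scaler0 addr0.
Qed.

(** Chinese remainder theorem. For a counterexample with nonzero [a] minimal for divisibility, write
    [a = p ^+ k.+1 * c] with [c] prime to [p]. Then [x] splits into [c *: x] of order [p ^+ k.+1]
    and [p ^+ k.+1 *: x] of order [c], and the latter is no counterexample, as [a] does not divide
    [c]. *)
Lemma cyclic_primary a x : annihilated_by x a ->
  exists t, [/\ seq_span t = seq_span [:: x], direct t &
                forall y, y \in t -> primary y].
Proof.
have [->|a0] := eqVneq a 0.
  move=> xa; exists [:: x]; split=> //=.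
    by split=> // c _ ->; rewrite addr0.
  move=> y; rewrite inE => /eqP->; exists 0, 0%N; split=> //.
  split=> [|b c [d _]]; first by rewrite unitr0.
  rewrite mulr0 => /esym/eqP; rewrite mulf_eq0.
  by move=> /orP[]/eqP->; [left|right]; exact: principal_ideal0.
move=> xa; apply: contrapT => hx.
have [|{}a [{}a0 [{xa hx}x xa hx]] amin] := @pid_divisibility_minimal _ hR [set a | a != 0 /\
  exists2 x, annihilated_by x a & ~ exists t, [/\ seq_span t = seq_span [:: x],
    direct t & forall y, y \in t -> primary y]].
  by exists a; split=> //; exists x.
apply: hx; have [aU|aU] := boolP (a \is a GRing.unit).
  have x0 : x = 0.
    by rewrite -[x]scale1r; apply/xa; exists a^-1; rewrite // mulVr.
  exists [::]; split=> //; apply: seq_span_eq => // y; rewrite inE x0 => /eqP->.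
  by have [] := seq_span_submodule (M := M) [::].
have [p [k [c [pP p0 pc aE]]]] := pid_prime_power_split hR a0 aU.
have pk0 : p ^+ k.+1 != 0 by rewrite expf_neq0.
have c0 : c != 0 by apply: contra_neq a0 => c0; rewrite aE c0 mulr0.
have [u [v uv]] := pid_prime_expr_bezout hR k.+1 pP p0 pc.
have annX : annihilated_by (p ^+ k.+1 *: x) c.
  move=> b; rewrite scalerA; split=> [/xa|[e _ <-]].
    by rewrite aE [b * _]mulrC => /principal_ideal_mul2l; exact.
  by apply/xa; exists e; rewrite // aE; ring.
have annY : annihilated_by (c *: x) (p ^+ k.+1).
  move=> b; rewrite scalerA; split=> [/xa|[e _ <-]].
    by rewrite aE [b * _]mulrC [p ^+ _ * _]mulrC => /principal_ideal_mul2l; exact.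
  by apply/xa; exists e; rewrite // aE; ring.
have [t [ts td tp]] : exists t, [/\ seq_span t = seq_span [:: p ^+ k.+1 *: x],
    direct t & forall y, y \in t -> primary y].
  apply: contrapT => ht; have [||f _ fE] := amin c.
  - by split=> //; exists (p ^+ k.+1 *: x).
  - by exists (p ^+ k.+1).
  have := pP.1; suff -> : p \is a GRing.unit by [].
  apply/unitrPr; exists (f * p ^+ k); apply: (mulfI c0); rewrite mulr1 -[RHS]fE aE.
  by rewrite exprS; ring.
exists (c *: x :: t); split.
- rewrite (seq_span_cons_eq _ ts); apply: seq_span_eq => y.
    rewrite !inE => /orP[]/eqP->; apply: seq_spanZ;
    by apply: mem_seq_span; rewrite mem_head.
  rewrite inE => /eqP->; exists v, (u *: (p ^+ k.+1 *: x)); split.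
    by apply: seq_spanZ; apply: mem_seq_span; rewrite mem_head.
  by rewrite !scalerA -scalerDl addrC uv scale1r.
- split=> // b y; rewrite ts => -[d [_ [-> ->]]]; rewrite addr0 !scalerA -scalerDl.
  move=> /xa[f _ fE]; apply/xa.
  (* The relation makes [p ^+ k.+1] divide [b * c]; Bezout removes the factor [c]. *)
  have [e _ eE] : principal_ideal (p ^+ k.+1) b.
    rewrite -[b]mulr1 -uv; exists (b * u + v * (f * c - d)) => //.
    have -> : b * (u * p ^+ k.+1 + v * c) = b * u * p ^+ k.+1 + v * (b * c) by ring.
    have -> : b * c = f * a - d * p ^+ k.+1 by rewrite fE; ring.
    by rewrite aE; ring.
  by exists e; rewrite // aE -eE; ring.
- by move=> y; rewrite in_cons => /orP[/eqP->|/tp//]; exists p, k.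
Qed.

Lemma annihilated_by_ex x : exists a, annihilated_by x a.
Proof.
have [|a aE] := hR (I := [set c | c *: x = 0]).
  split=> /= [|b c hb hc|b c hc]; first exact: scale0r.
    by rewrite scalerDl hb hc addr0.
  by rewrite -scalerA hc scaler0.
by exists a => c; rewrite -aE.
Qed.

Lemma direct_primary t : direct t ->
  exists s, [/\ seq_span s = seq_span t, direct s & forall y, y \in s -> primary y].
Proof.
elim: t => [_|x t IH [dx /IH[s [st sd sp]]]]; first by exists [::].
have [a xa] := annihilated_by_ex x; have [r [rx rd rp]] := cyclic_primary xa.
exists (r ++ s); split.
- rewrite -(seq_span_cons_eq x st); apply/seteqP; split=> z.
    move=> /seq_span_cat[y [w [+ hw ->]]]; rewrite rx => -[c [_ [-> ->]]].
    by exists c, w; rewrite addr0.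
  move=> [c [w [hw ->]]]; apply/seq_span_cat; exists (c *: x), w; split=> //.
  by rewrite rx; exists c, 0; rewrite addr0.
- apply: direct_cat => // y z; rewrite rx st => -[c [_ [-> ->]]].
  by rewrite addr0; exact: dx.
- by move=> y; rewrite mem_cat => /orP[/rp|/sp].
Qed.

Lemma span_direct_primary s :
  exists t, [/\ seq_span t = seq_span s, direct t & forall y, y \in t -> primary y].
Proof. by have [r [<- /direct_primary]] := span_direct s. Qed.

End Decomposition.

(** * Homogeneous components and homogeneous generators *)

Section Components.
Variables (R : idomainType) (M : lmodType R) (G : nat -> set M).
Hypothesis hG : graded_module (zero_grading R) G.

Lemma graded_submodule n : is_submodule (G n).
Proof.
have [[/(_ n)[G0 GB] _] GZ] := hG; split=> // [x y Gx Gy|c x Gx].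
  by rewrite -[y]opprK; apply: (GB) => //; rewrite -sub0r; exact: GB.
exact: (GZ 0%N).
Qed.

Lemma sum_widen (f : nat -> M) m m' : (m <= m')%N ->
  (forall n, (m <= n)%N -> f n = 0) -> \sum_(n < m) f n = \sum_(n < m') f n.
Proof.
move=> mm' f0; rewrite (big_ord_widen _ f mm') big_mkcond.
by apply: eq_bigr => i _; case: ltnP => // /f0.
Qed.

(** Uniqueness of the decomposition identifies any family of homogeneous elements with the right sum
    as the components. Linearity and the values on homogeneous elements follow by exhibiting such
    families. *)
Lemma graded_components : exists comp : nat -> M -> M,
  [/\ forall n x, G n (comp n x),
      forall x, (forall n, comp n x = 0) -> x = 0,
      forall x, exists m, forall n, (m <= n)%N -> comp n x = 0,
      forall n c x y, comp n (c *: x + y) = c *: comp n x + comp n y &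
      forall n m x, G m x -> comp n x = if n == m then x else 0].
Proof.
have [comp compP] := choice hG.1.2.
have compE x (f : nat -> M) m : (forall n, G n (f n)) ->
    (forall n, (m <= n)%N -> f n = 0) -> x = \sum_(n < m) f n -> comp x = f.
  by move=> Gf f0 xE; apply: (compP x).2; split=> //; exists m.
exists (fun n x => comp x n); split.
- by move=> n x; have [[]] := compP x.
- by move=> x x0; have [[_ [m [_ ->]]] _] := compP x; exact: big1.
- by move=> x; have [[_ [m []]]] := compP x; exists m.
- move=> n c x y.
  have [[Gx [m [xm xE]]] _] := compP x; have [[Gy [m' [ym yE]]] _] := compP y.
  pose f n := c *: comp x n + comp y n.
  rewrite (compE _ f (maxn m m')) //.
  + by move=> k; have [_ GD GZ] := graded_submodule k; apply/GD => //; exact: GZ.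
  + move=> k; rewrite geq_max => /andP[mk m'k].
    by rewrite /f xm // ym // scaler0 addr0.
  + rewrite {1}xE {1}yE (sum_widen (leq_maxl m m') xm) (sum_widen (leq_maxr m m') ym).
    by rewrite scaler_sumr -big_split.
- move=> n m x Gx; rewrite (compE x (fun n => if n == m then x else 0) m.+1) //.
  + by move=> k; case: eqP => [->//|_]; have [] := graded_submodule k.
  + by move=> k mk; rewrite gtn_eqF.
  + by rewrite big_ord_recr /= eqxx big1 ?add0r // => i _; rewrite ltn_eqF.
Qed.

(** The degree [k] part is generated by the degree [k] components of the generators of [M], so it
    can be decomposed on its own; only finitely many degrees occur. *)
Lemma graded_direct_primary : is_PID R -> finitely_generated M ->
  exists t, [/\ forall x, seq_span t x, direct t, forall y, y \in t -> primary y &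
                forall y, y \in t -> homogeneous G y].
Proof.
move=> hR [n [g gP]]; have [comp [Gc c0 cfin cL cG]] := graded_components.
have cZ k c x : comp k (c *: x) = c *: comp k x.
  have [z _ _] := graded_submodule k.
  by rewrite -[c *: x]addr0 cL (cG k k 0 z) eqxx addr0.
have cD k x y : comp k (x + y) = comp k x + comp k y.
  by rewrite -[x]scale1r cL !scale1r.
have c00 k : comp k 0 = 0 by have [z _ _] := graded_submodule k; rewrite (cG k k) ?eqxx.
have csum k (c : 'I_n -> R) : comp k (\sum_i c i *: g i) = \sum_i c i *: comp k (g i).
  by rewrite (big_morph _ (cD k) (c00 k)); apply: eq_bigr => i _; rewrite cZ.
(* All components of [g i] lie in degrees below [b i], so those of any element lie below
   [\max_i b i]. *)
have [b bP] := choice (fun i => cfin (g i)).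
have bound k x : (\max_i b i <= k)%N -> comp k x = 0.
  have [c ->] := gP x => hk; rewrite csum big1 // => i _.
  by rewrite bP ?scaler0 //; apply: leq_trans hk; exact: leq_bigmax.
have spanG d : seq_span [seq comp d (g i) | i <- enum 'I_n] = G d.
  apply/seteqP; split.
    apply: seq_span_sub; first exact: graded_submodule.
    by move=> _ /mapP[i _ ->].
  move=> x Gx; have [c xE] := gP x.
  have -> : x = \sum_i c i *: comp d (g i) by rewrite -csum -xE (cG d d) ?eqxx.
  elim/big_ind: _ => [|y z|i _]; first by have [] := seq_span_submodule
      [seq comp d (g i) | i <- enum 'I_n].
    exact: seq_spanD.
  by apply: seq_spanZ; apply/mem_seq_span/map_f; rewrite mem_enum.
(* The families of the degrees below [k] are concatenated; they span the elements without components
   in degree [k] or higher. *)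
have step k : exists t, [/\ seq_span t = [set x | forall j, (k <= j)%N -> comp j x = 0],
    direct t, forall y, y \in t -> primary y & forall y, y \in t -> homogeneous G y].
  elim: k => [|k [t [tE td tp th]]].
    exists [::]; split=> //; apply/seteqP; split=> [_ -> j _|x xj]; first exact: c00.
    by apply: c0 => j; exact: xj.
  have [s [sE sd sp]] := span_direct_primary hR [seq comp k (g i) | i <- enum 'I_n].
  rewrite spanG in sE; exists (t ++ s); split.
  - apply/seteqP; split=> x.
      move=> /seq_span_cat[y [z [+ + ->]]] j kj.
      rewrite tE sE cD => /(_ j (ltnW kj)) -> /(cG j) ->.
      by rewrite gtn_eqF // addr0.
    move=> xk; apply/seq_span_cat; exists (x - comp k x), (comp k x).
    rewrite tE sE subrK; split=> // j; rewrite leq_eqVlt addrC -scaleN1r cL scaleN1r.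
    rewrite (cG j k) // => /orP[/eqP <-|kj]; first by rewrite eqxx addNr.
    by rewrite gtn_eqF // oppr0 add0r xk.
  - apply: direct_cat => // x y; rewrite tE sE => xk yk xy0.
    have yk0 : y = 0.
      by have := cD k x y; rewrite xy0 c00 (xk k) // add0r (cG k k) // eqxx.
    by rewrite yk0 addr0 in xy0.
  - by move=> y; rewrite mem_cat => /orP[/tp|/sp].
  - by move=> y; rewrite mem_cat => /orP[/th//|/mem_seq_span]; rewrite sE; exists k.
have [t [tE td tp th]] := step (\max_i b i).
by exists t; split=> // x; rewrite tE => j; exact: bound.
Qed.

End Components.

(** * From direct families of homogeneous primary generators to graded decompositions *)

Lemma cyclic_pi0 (R : idomainType) (a : R) : cyclic_pi a 0 = 0.
Proof. by apply: (addrI (cyclic_pi a 0)); rewrite -cyclic_piD !addr0. Qed.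

Section CyclicMap.
Variables (R : idomainType) (M : lmodType R) (y : M) (a : R).
Hypothesis ya : annihilated_by y a.

Definition cyclic_map (v : cyclic_module a) : M :=
  repr (v : Quotient.quot (principal_pred a)) *: y.

Lemma cyclic_map_pi r : cyclic_map (cyclic_pi a r) = r *: y.
Proof.
apply/eqP; rewrite -subr_eq0 -scalerBl; apply/eqP/ya.
exact: (iffLR (cyclic_pi_eq _ _ _) (cyclic_pi_repr _)).
Qed.

Lemma cyclic_map_linear : linear cyclic_map.
Proof.
move=> c v w; rewrite -[v]cyclic_pi_repr -[w]cyclic_pi_repr.
rewrite -[c *: _]/(cyclic_scale _ _) cyclic_scale_pi -cyclic_piD !cyclic_map_pi.
by rewrite scalerDl scalerA.
Qed.

Lemma cyclic_map_eq0 v : cyclic_map v = 0 -> v = 0.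
Proof.
rewrite -[v]cyclic_pi_repr cyclic_map_pi => /ya ar.
by rewrite -(cyclic_pi0 a); apply/cyclic_pi_eq; rewrite subr0.
Qed.

End CyclicMap.

Lemma linear_exists (R : idomainType) (U V : lmodType R) (f : U -> V) :
  linear f -> exists g : {linear U -> V}, g =1 f.
Proof.
move=> fl; pose L := GRing.isLinear.Build R U V *:%R f fl.
pose g : {linear U -> V} := HB.pack f L.
by exists g.
Qed.

Lemma zero_grading_homogeneous (R : idomainType) (p : R) : homogeneous (zero_grading R) p.
Proof. by exists 0%N. Qed.

(** For the zero grading [R/(a)] is concentrated in degree 0, hence its shift in degree [s]. *)
Lemma shift_cyclic_grading (R : idomainType) (a : R) s n v :
  shift_grading s (cyclic_grading (zero_grading R) a) n v <-> (s != n -> v = 0).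
Proof.
rewrite /shift_grading /cyclic_grading /zero_grading.
case: ltngtP => [sn|ns|->] /=; last 2 first.
- by split=> [//|]; apply.
- rewrite subnn; split=> // _; exists (repr (v : Quotient.quot (principal_pred a))) => //.
  exact: cyclic_pi_repr.
rewrite -subn_gt0 in sn; case: (n - s)%N sn => // k _.
split=> [[_ -> <-] _|->//]; first exact: cyclic_pi0.
by exists 0 => //; exact: cyclic_pi0.
Qed.

Section DecompositionExists.
Variables (R : idomainType) (M : lmodType R) (G : nat -> set M).
Hypothesis hG : graded_module (zero_grading R) G.

Lemma graded_decomposition_of_direct (t : seq M) :
  (forall x, seq_span t x) -> direct t ->
  (forall y, y \in t -> primary y) -> (forall y, y \in t -> homogeneous G y) ->
  exists D, graded_prime_power_decomposition (zero_grading R) G D.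
Proof.
move=> tspan td tp th.
have data (i : 'I_(size t)) : exists d : nat * R * nat, [/\ G d.1.1 t`_i, prime_elem d.1.2 &
    annihilated_by t`_i (d.1.2 ^+ d.2.+1)].
  have it : t`_i \in t by exact: mem_nth.
  have [n Gn] := th _ it; have [p [k [pP ann]]] := tp _ it.
  by exists (n, p, k).
have [d dP] := choice data.
pose D := PrimePowerData (fun i => (d i).1.1) (fun i => (d i).1.2) (fun i => (d i).2.+1).
exists D; split=> //= [i|i|]; [by have [] := dP i|exact: zero_grading_homogeneous|].
have ann (i : 'I_(ppd_size D)) : annihilated_by t`_i (ppd_prime i ^+ ppd_exp i).
  by have [] := dP i.
pose h (u : ppd_module D) : M := \sum_(i < size t) cyclic_map t`_i (u i).
have hlin : linear h.
  move=> c u v; rewrite /h scaler_sumr -big_split; apply: eq_bigr => i _ /=.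
  by rewrite -(cyclic_map_linear (ann i)) !ffunE.
have [g gE] := linear_exists hlin.
have ginj u : g u = 0 -> u = 0.
  rewrite gE /h => E; apply/ffunP => i; rewrite ffunE.
  apply: (cyclic_map_eq0 (ann i)).
  (* Coefficients indexed by [nat], as [direct_nth] expects, with 0 beyond the size of [t]. *)
  pose c k := if insub k is Some j then repr (u j : Quotient.quot
    (principal_pred (ppd_prime (p := D) j ^+ ppd_exp j))) else 0.
  have cE (j : 'I_(size t)) : c j *: t`_j = cyclic_map t`_j (u j) by rewrite /c valK.
  rewrite -cE; apply: (direct_nth td) => //; rewrite -[RHS]E.
  by apply: eq_bigr => j _.
have gsurj x : exists u, g u = x.
  have [c ->] := (seq_span_nth t x).1 (tspan x).
  pose u : ppd_module D := [ffun i : 'I_(ppd_size D) =>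
    (cyclic_pi (ppd_prime i ^+ ppd_exp i) (c i) : ppd_summand i)].
  exists u; rewrite gE; apply: eq_bigr => i _.
  by rewrite ffunE (cyclic_map_pi (ann i)).
have [f0 f0K] := choice gsurj.
have gf0 : cancel g f0.
  by move=> u; apply/eqP; rewrite -subr_eq0; apply/eqP/ginj; rewrite linearB f0K subrr.
have flin : linear f0.
  move=> c x y; apply: (can_inj gf0); rewrite linearP.
  by rewrite !f0K.
have [f fE] := linear_exists flin.
have map0 (i : 'I_(ppd_size D)) :
    cyclic_map (a := ppd_prime i ^+ ppd_exp i) t`_i 0 = 0.
  by rewrite -cyclic_pi0 (cyclic_map_pi (ann i)) scale0r.
have Gt (i : 'I_(size t)) : G (d i).1.1 t`_i by have [] := dP i.
exists f, g; split=> [x|u|n x Gx|n u Gu].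
- by rewrite fE f0K.
- by rewrite fE gf0.
- have [comp [_ _ _ cL cG]] := graded_components hG.
  have [G0 _ _] := graded_submodule hG n.
  have c00 : comp n 0 = 0 by rewrite (cG n n) ?eqxx.
  have cD y z : comp n (y + z) = comp n y + comp n z.
    by rewrite -[y]scale1r cL !scale1r.
  (* Each summand maps into a single degree, so [g] sends [v], the part of [f x] in the summands
     shifted by [n], to the degree [n] component of [x], which is [x] itself. *)
  pose v : ppd_module D := [ffun i => if ppd_shift i == n then f x i else 0].
  have -> : f x = v; last first.
    by move=> i; apply/shift_cyclic_grading; rewrite ffunE => /negbTE ->.
  rewrite fE; rewrite -[v]gf0; congr f0.
  have xE : comp n x = \sum_(i < size t) comp n (cyclic_map t`_i (f x i)).
    by rewrite -(big_morph _ cD c00) -/(h (f x)) -gE fE f0K.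
  transitivity (comp n x); first by rewrite (cG n n) ?eqxx.
  rewrite gE xE; apply: eq_bigr => i _.
  rewrite ffunE (cG _ (d i).1.1); last first.
    by have [_ _] := graded_submodule hG (d i).1.1; apply.
  by rewrite eq_sym; case: eqP; rewrite ?map0.
rewrite gE /h; elim/big_ind: _ => [|y z|i _].
- by have [] := graded_submodule hG n.
- by have [_ + _] := graded_submodule hG n; apply.
have [_ _ GZ] := graded_submodule hG n.
have [<-|ne] := eqVneq (d i).1.1 n; first by have [_ _] := graded_submodule hG (d i).1.1; apply.
have [G0 _ _] := graded_submodule hG n.
by have /shift_cyclic_grading -> := Gu i; rewrite ?map0.
Qed.
End DecompositionExists.

(** * Ulm invariants of a decomposition *)

(* Gaussian elimination over [R/(p)]. *)
Lemma prime_elem_dependent (R : idomainType) (p : R) m n (A : 'I_m -> 'I_n -> R) :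
  prime_elem p -> (n < m)%N ->
  exists c : 'I_m -> R, (exists i, ~ principal_ideal p (c i)) /\
    forall j, principal_ideal p (\sum_i c i * A i j).
Proof.
move=> pP; elim: n m A => [|n IH] [//|m] A nm.
  exists (fun=> 1); split; last by case.
  exists ord0 => /principal_ideal_unit; rewrite unitr1 (negbTE pP.1).
  by move=> /(_ isT).
(* A first column divisible by [p] imposes no condition and is dropped. *)
case: (pselect (forall i, principal_ideal p (A i ord0))) => [A0|].
  have [c [ci cP]] := IH m.+1 (fun i j => A i (lift ord0 j)) (ltnW nm).
  exists c; split=> // j; case: (unliftP ord0 j) => [j' ->|->]; first exact: cP.
  by apply: principal_ideal_sum => i _; exact: principal_ideal_mull.
move=> /existsNP[i0 npa]; set a := A i0 ord0 in npa.
(* Cross-multiplication with the pivot row [i0] clears the first column without dividing by [a]. *)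
pose B i j := a * A (lift i0 i) (lift ord0 j) - A (lift i0 i) ord0 * A i0 (lift ord0 j).
have [c [[k ck] cP]] := IH m B nm.
(* The coefficient of the pivot row makes the first column cancel exactly; the others stay nonzero
   modulo [p] where [c] is, since [p] does not divide [a]. *)
pose c' i := if unlift i0 i is Some k then c k * a
             else - \sum_k c k * A (lift i0 k) ord0.
exists c'; split.
  by exists (lift i0 k); rewrite /c' liftK => /pP.2[].
move=> j; rewrite (bigD1_ord i0) //= {1}/c' unlift_none.
under eq_bigr do rewrite /c' liftK.
case: (unliftP ord0 j) => [j' ->|->].
  have := cP j'; congr principal_ideal; rewrite mulNr mulr_suml -sumrN -big_split.
  by apply: eq_bigr => i _ /=; rewrite /B; ring.
rewrite [X in principal_ideal _ X](_ : _ = 0); first exact: principal_ideal0.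
rewrite mulNr mulr_suml -sumrN -big_split big1 //= => i _.
by rewrite -/a; ring.
Qed.

(* For [p != 0] the largest such [m] is the dimension over [R/(p)] of [N / (N `&` L)]
   with [N] the image under [p^k] of the [p^(k+1)]-torsion of [M_n] and [L = p^(k+1) M];
   for [p = 0] and [k = 0] it is the rank of [M_n]. *)
Definition ulm_independent (R : idomainType) (M : lmodType R) (G : nat -> set M)
    (n : nat) (p : R) (k m : nat) : Prop :=
  exists y : 'I_m -> M, [/\ forall i, G n (y i), forall i, p ^+ k.+1 *: y i = 0 &
    forall (c : 'I_m -> R) z, \sum_i c i *: (p ^+ k *: y i) = p ^+ k.+1 *: z ->
    forall i, principal_ideal p (c i)].

Lemma ulm_independent_iso (R : idomainType) (M M' : lmodType R)
    (G : nat -> set M) (G' : nat -> set M') n p k m : graded_iso G G' ->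
  ulm_independent G n p k m <-> ulm_independent G' n p k m.
Proof.
suff tr (V W : lmodType R) (H : nat -> set V) (H' : nat -> set W)
    (f : {linear V -> W}) (g : {linear W -> V}) : cancel f g -> cancel g f ->
    (forall n x, H n x -> H' n (f x)) ->
    ulm_independent H n p k m -> ulm_independent H' n p k m.
  by move=> [f [g [fK gK fG gG]]]; split; [exact: tr fK gK fG | exact: tr gK fK gG].
move=> fK gK fG [y [yG y0 yP]]; exists (fun i => f (y i)); split=> [i|i|c z E].
- exact: fG.
- by rewrite -linearZ y0 linear0.
- apply: (yP c (g z)); apply: (can_inj fK); rewrite linear_sum linearZ /= gK -E.
  by apply: eq_bigr => i _; rewrite linearZ /= linearZ.
Qed.

Lemma dirsum_sumE (R : idomainType) N (V : 'I_N -> lmodType R) (I : finType)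
    (F : I -> dirsum V) j : (\sum_i F i) j = \sum_i F i j.
Proof.
by apply: (big_morph (fun u : dirsum V => u j)) => [u v|]; rewrite ffunE.
Qed.

Section UlmInvariant.
Variables (R : idomainType) (D : prime_power_data R).
Hypothesis Dprime : forall j : 'I_(ppd_size D), prime_elem (ppd_prime j).
Hypothesis Dexp : forall j : 'I_(ppd_size D), (0 < ppd_exp j)%N.
Variables (n : nat) (p : R) (k : nat).
Hypotheses (pP : prime_elem p) (p0k : p = 0 -> k = 0%N).

Let a (j : 'I_(ppd_size D)) := ppd_prime j ^+ ppd_exp j.
Let J := [pred j : 'I_(ppd_size D) |
  (ppd_shift j, unit_orbit (a j)) == (n, unit_orbit (p ^+ k.+1))].

Lemma cyclic_scaleE (b c x : R) : c *: cyclic_pi b x = cyclic_pi b (c * x).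
Proof. exact: cyclic_scale_pi. Qed.

(** The witnesses are the generators of the summands in [J], whose orders are associated to
    [p ^+ k.+1]. Each coordinate of a relation gives that [p ^+ k.+1] divides [p ^+ k * c i]. *)
Lemma ulm_independent_card :
  ulm_independent (ppd_grading (zero_grading R) D) n p k #|J|.
Proof.
have aP (i : 'I_#|J|) x :
    principal_ideal (a (enum_val i)) x <-> principal_ideal (p ^+ k.+1) x.
  have /eqP[_ /unit_orbit_eq[u uU ->]] := enum_valP i.
  split=> -[c _ <-]; first by exists (c * u); rewrite ?mulrA.
  by exists (c / u); rewrite // mulrA divrK.
exists (fun i => [ffun j => if j == enum_val i then cyclic_pi (a j) 1 else 0]).
split=> [i j|i|c z E i].
- apply/shift_cyclic_grading; rewrite ffunE.
  have [->|//] := eqVneq j (enum_val i); move=> /eqP.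
  by have /eqP[] := enum_valP i.
- apply/ffunP => j; rewrite !ffunE; case: eqP => [->|_]; last exact: scaler0.
  rewrite cyclic_scaleE -(cyclic_pi0 (a (enum_val i))); apply/cyclic_pi_eq.
  by apply/aP; rewrite mulr1 subr0; exact: principal_ideal_refl.
have := congr1 (fun u : ppd_module D => u (enum_val i)) E.
rewrite dirsum_sumE (bigD1 i) //= big1 => [|l li]; last first.
  rewrite !ffunE; case: eqP => [/enum_val_inj il|_]; last by rewrite !scaler0.
  by rewrite il eqxx in li.
rewrite addr0 !ffunE eqxx [p ^+ k *: _]cyclic_scaleE cyclic_scaleE.
set w := z (enum_val i); rewrite -[w]cyclic_pi_repr cyclic_scaleE => /cyclic_pi_eq.
set r := repr _; rewrite mulr1 => /aP[e _ eE].
(* For [p = 0] this rests on [k = 0], where the power is 1. *)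
have pk0 : p ^+ k != 0.
  by have [/p0k ->|p0] := eqVneq p 0; rewrite ?expr0 ?oner_eq0 // expf_neq0.
apply: (principal_ideal_mul2l pk0); exists (e + r) => //.
have -> : p ^+ k * c i = c i * p ^+ k - p ^+ k.+1 * r + p ^+ k.+1 * r by ring.
by rewrite -eE exprS; ring.
Qed.

Let kills j c : Prop := ~ principal_ideal p c /\
  forall v : cyclic_module (a j), (ppd_shift j != n -> v = 0) -> p ^+ k.+1 *: v = 0 ->
  exists e, c *: (p ^+ k *: v) = cyclic_pi (a j) (p ^+ k.+1 * e).

Lemma other_summand_killed j : ~~ J j -> exists c, kills j c.
Proof.
rewrite /J /= xpair_eqE negb_and => /orP[jn|jp].
  exists 1; split=> [/principal_ideal_unit|v /(_ jn) -> _].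
    by rewrite unitr1 (negbTE pP.1) => /(_ isT).
  by exists 0; rewrite mulr0 cyclic_pi0 !scaler0.
have aE : a j = ppd_prime j ^+ (ppd_exp j).-1.+1 by rewrite prednK.
have [|c pc cP] := other_prime_power_killed (l := (ppd_exp j).-1) pP (Dprime j) p0k.
  by rewrite -aE; exact/eqP.
exists c; split=> // v _; rewrite -[v]cyclic_pi_repr; set r := repr _.
rewrite -(cyclic_pi0 (a j)) cyclic_scaleE => /cyclic_pi_eq; rewrite subr0 aE.
move=> /cP[e he]; exists e.
by rewrite -aE !cyclic_scaleE; apply/cyclic_pi_eq; rewrite aE.
Qed.

(** With more than [#|J|] elements, elimination gives a combination [v], nontrivial modulo [p],
    whose coordinates in [J] are multiples of [p]. Let [b] be the product of the elements that kill
    the other summands. Then [b *: (p ^+ k *: v)] is a multiple of [p ^+ k.+1], yet its coefficients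
    are not all divisible by [p]. *)
Lemma ulm_independent_le m :
  ulm_independent (ppd_grading (zero_grading R) D) n p k m -> (m <= #|J|)%N.
Proof.
move=> [y [yG y0 yP]]; rewrite leqNgt; apply/negP => mJ.
pose r i j := repr (y i j : Quotient.quot (principal_pred (a j))).
have [c [[i0 ci0] cP]] := prime_elem_dependent (fun i j => r i (enum_val j)) pP mJ.
have /choice[g gP] j : exists x, ~~ J j -> kills j x.
  by have [_|/other_summand_killed[x xP]] := boolP (J j); [exists 0 | exists x].
pose b := \prod_(j | ~~ J j) g j.
have pb : ~ principal_ideal p b by apply: prime_elem_prod => // j /gP[].
pose v : ppd_module D := \sum_i c i *: y i.
have vE j : v j = \sum_i c i *: y i j.
  by rewrite /v dirsum_sumE; apply: eq_bigr => i _; rewrite ffunE.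
have v0 : p ^+ k.+1 *: v = 0.
  rewrite scaler_sumr big1 // => i _.
  by rewrite scalerA mulrC -scalerA y0 scaler0.
have /choice[e eP] j : exists e,
    b *: (p ^+ k *: v j) = cyclic_pi (a j) (p ^+ k.+1 * e).
  have [Jj|nJj] := boolP (J j).
    have [e _ eE] := cP (enum_rank_in Jj j).
    exists (b * e); have -> : v j = cyclic_pi (a j) (e * p).
      rewrite eE enum_rankK_in // vE (big_morph _ (@cyclic_piD R (a j)) (cyclic_pi0 _)).
      by apply: eq_bigr => i _; rewrite -cyclic_scaleE cyclic_pi_repr.
    by rewrite scalerA cyclic_scaleE exprS; congr cyclic_pi; ring.
  have [| |e eE] := (gP j nJj).2 (v j).
  - move=> jn; rewrite vE big1 // => i _.
    by have /shift_cyclic_grading -> // := yG i j; rewrite scaler0.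
  - by have := congr1 (fun u : ppd_module D => u j) v0; rewrite !ffunE.
  exists (\prod_(i | ~~ J i && (i != j)) g i * e).
  rewrite /b (bigD1 j) //= mulrC -scalerA eE cyclic_scaleE.
  by congr cyclic_pi; ring.
have [] : ~ principal_ideal p (b * c i0) by move=> /pP.2[].
apply: (yP (fun i => b * c i) [ffun j => cyclic_pi (a j) (e j)]).
apply/ffunP => j; rewrite !ffunE cyclic_scaleE -eP vE dirsum_sumE.
rewrite !scaler_sumr; apply: eq_bigr => i _; rewrite !ffunE !scalerA.
by congr (_ *: _); ring.
Qed.
End UlmInvariant.

(** * Uniqueness of the signature *)

Section SignatureUnique.
Variables (R : idomainType) (M : lmodType R) (G : nat -> set M).

Let key (D : prime_power_data R) (j : 'I_(ppd_size D)) : nat * set R :=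
  (ppd_shift j, unit_orbit (ppd_prime j ^+ ppd_exp j)).

Lemma ppd_signatureE (D : prime_power_data R) z :
  ppd_signature D z = #|[pred j : 'I_(ppd_size D) | key j == z]|.
Proof. by rewrite mset_seqE count_map cardE -size_filter enumT. Qed.

(** The independent elements given by one decomposition are carried through [M] to the other, where
    they bound the count from below; symmetry gives equality. *)
Lemma signature_multiplicity (D D' : prime_power_data R) n p k :
  graded_prime_power_decomposition (zero_grading R) G D ->
  graded_prime_power_decomposition (zero_grading R) G D' ->
  prime_elem p -> (p = 0 -> k = 0%N) ->
  ppd_signature D (n, unit_orbit (p ^+ k.+1)) =
  ppd_signature D' (n, unit_orbit (p ^+ k.+1)).
Proof.
move=> hD hD' pP pk; apply: anti_leq; rewrite !ppd_signatureE.
suff le (C C' : prime_power_data R) :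
    graded_prime_power_decomposition (zero_grading R) G C ->
    graded_prime_power_decomposition (zero_grading R) G C' ->
    (#|[pred j : 'I_(ppd_size C) | key j == (n, unit_orbit (p ^+ k.+1))]| <=
     #|[pred j : 'I_(ppd_size C') | key j == (n, unit_orbit (p ^+ k.+1))]|)%N.
  by rewrite !le.
move=> [Cp _ Ce isoC] [Cp' _ Ce' isoC'].
apply: (ulm_independent_le Cp' Ce' pP pk).
apply/(ulm_independent_iso _ _ _ _ isoC').
apply/(ulm_independent_iso _ _ _ _ isoC).
exact: ulm_independent_card.
Qed.

(** All positive powers of 0 coincide, so for the prime 0 the exponent can be normalised to 1. *)
Lemma key_prime_power (D : prime_power_data R) (j : 'I_(ppd_size D)) :
  graded_prime_power_decomposition (zero_grading R) G D ->
  exists p k, [/\ prime_elem p, p = 0 -> k = 0%N &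
                  key j = (ppd_shift j, unit_orbit (p ^+ k.+1))].
Proof.
move=> [Dp _ De _]; exists (ppd_prime j).
have [p0|p0] := eqVneq (ppd_prime j) 0.
  by exists 0%N; split=> //; rewrite /key p0 !expr0n eqn0Ngt De.
exists (ppd_exp j).-1; split=> // [/eqP|]; first by rewrite (negbTE p0).
by rewrite /key prednK.
Qed.

Lemma signature_unique (D D' : prime_power_data R) :
  graded_prime_power_decomposition (zero_grading R) G D ->
  graded_prime_power_decomposition (zero_grading R) G D' ->
  ppd_signature D = ppd_signature D'.
Proof.
(* Multiplicities need comparing only at pairs that occur in one of the signatures. *)
move=> hD hD'; apply/eq_seq_msetP/allP => z.
rewrite mem_cat /= -!mset_seqE -/(ppd_signature D) -/(ppd_signature D').
suff eqz (C : prime_power_data R) (j : 'I_(ppd_size C)) :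
    graded_prime_power_decomposition (zero_grading R) G C ->
    ppd_signature D (key j) = ppd_signature D' (key j).
  by move=> /orP[]/mapP[j _ ->]; apply/eqP; exact: eqz.
move=> /(key_prime_power j)[p [k [pP pk ->]]].
exact: signature_multiplicity.
Qed.
End SignatureUnique.

Theorem proposition4p2 (R : idomainType) (hR : is_PID R)
    (M : lmodType R) (MG : nat -> set M)
    (hMG : graded_module (zero_grading R) MG)
    (hM : finitely_generated M) :
  (exists D : prime_power_data R,
     graded_prime_power_decomposition (zero_grading R) MG D) /\
  (forall D D' : prime_power_data R,
     graded_prime_power_decomposition (zero_grading R) MG D ->
     graded_prime_power_decomposition (zero_grading R) MG D' ->
     ppd_signature D = ppd_signature D').
Proof.
split; last exact: signature_unique.
have [t [tspan td tp th]] := graded_direct_primary hMG hR hM.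
exact: graded_decomposition_of_direct tspan td tp th.
Qed.
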